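(* For a finite group $G$ let $f(G)=\frac{m(G)}{|G|^2}$, where $m(G)=\max\{|H|\,|C_G(H)| : H\leq G\}$. Let $d$ be a positive integer, and write $d=p_1^{n_1}\cdots p_k^{n_k}$, where $k\geq 1$, $p_1,\dots,p_k$ are distinct primes, and $n_1,\dots,n_k$ are non-negative integers. The following hold: 1. If $n_1=\dots=n_k=0$, or $n_i\geq 2$ for all $i=1,\dots,k$, then there exists a finite group $G$ with $f(G)=\frac{1}{d}$. 2. If $n_1=\dots=n_k=1$, then there is no finite group $G$ with $f(G)=\frac{1}{d}$.
   Context: For a finite group $G$ and a subgroup $H\leq G$, $C_G(H)$ denotes the centralizer of $H$ in $G$, and the Chermak-Delgado measure of $H$ is $m_G(H)=|H|\,|C_G(H)|$. The Chermak-Delgado measure of $G$ is $m(G)=\max\{m_G(H) : H\leq G\}$, and $f(G)=\frac{m(G)}{|G|^2}$. *)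

(* Defs.v *)
From mathcomp Require Import all_boot all_order all_algebra all_fingroup.

Set Implicit Arguments.
Unset Strict Implicit.
Unset Printing Implicit Defensive.

Definition cd_measure (gT : finGroupType) (G H : {group gT}) : nat :=
  #|H| * #|'C_G(H)%g|.

Definition cd_max (gT : finGroupType) (G : {group gT}) : nat :=
  \max_(H : {group gT} | H \subset G) cd_measure G H.

Definition cd_ratio (gT : finGroupType) (G : {group gT}) : rat :=
  ((cd_max G)%:R / #|G|%:R ^+ 2)%R.

(* Main.v *)
Require Import Defs.
From HB Require Import structures.
From mathcomp Require Import all_boot all_order all_algebra all_fingroup.
From mathcomp Require Import all_solvable.
From mathcomp Require Import zify.

Set Implicit Arguments.
Unset Strict Implicit.
Unset Printing Implicit Defensive.

(** For part 1, f is multiplicative on direct products, so prime powers p^n with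
    n >= 2 suffice. On V x (V (x) V), V = F_p^n, consider the law
    (u, A)(v, B) = (u + v, A + B + u (x) v). Two elements commute iff their
    V-components are linearly dependent, so every subgroup H satisfies
    |H| |C(H)| <= |G| |V (x) V|, with equality for H = G.

    For part 2, some abelian M has maximal measure; with C = C_G(M) this gives
    d = |C : M| |G : C|^2, so for d squarefree M is central and |G / M| = d.
    A group Q of squarefree order is solvable, hence has a normal cyclic
    self-centralizing subgroup F, and |Q| <= |F| |Aut F| < |F|^2 when Q is
    nontrivial. For Q = G / M the preimage of F is abelian, and its measure
    exceeds |M| |G| = m(G). *)

(** * Subgroups of maximal Chermak-Delgado measure *)

Section Measure.

Local Open Scope group_scope.

Variables (gT : finGroupType) (G : {group gT}).

Lemma cd_measure_le_max (H : {group gT}) :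
  H \subset G -> (cd_measure G H <= cd_max G)%N.
Proof.
exact: (@leq_bigmax_cond _ (fun H : {group gT} => H \subset G)).
Qed.

Lemma cd_max_attained :
  exists2 H : {group gT}, H \subset G & cd_measure G H = cd_max G.
Proof.
have [|H sHG maxH] :=
    @eq_bigmax_cond _ [pred H : {group gT} | H \subset G] (cd_measure G).
  by apply/card_gt0P; exists G; rewrite inE /=.
by exists H => //; rewrite -maxH.
Qed.

(** Clearing denominators lets the remaining argument stay in the natural numbers. *)
Lemma cd_ratioP d : (0 < d)%N ->
  (cd_ratio G = (1 / d%:R)%R) <-> (cd_max G * d = #|G| ^ 2)%N.
Proof.
move=> d_gt0; rewrite /cd_ratio -GRing.natrX.
have natr_neq0 n : (0 < n)%N -> (n%:R != 0 :> rat)%R.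
  by rewrite Num.Theory.pnatr_eq0 -lt0n.
have dnz := natr_neq0 _ d_gt0.
have G2nz : ((#|G| ^ 2)%:R != 0 :> rat)%R.
  by apply: natr_neq0; rewrite expn_gt0 cardG_gt0.
apply: (iff_trans (rwP eqP)).
rewrite GRing.eqr_div // GRing.mul1r -GRing.natrM Num.Theory.eqr_nat.
exact: iff_sym (rwP eqP).
Qed.

(* If [H] has maximal measure then so does its centralizer, and
   [m H * m K <= m (H <*> K) * m (H :&: K)], so [H :&: 'C_G(H)] has maximal
   measure as well. *)
Lemma cd_max_attained_abelian :
  exists M : {group gT},
    [/\ M \subset G, abelian M & cd_measure G M = cd_max G].
Proof.
have [H sHG maxH] := cd_max_attained.
pose K := 'C_G(H)%G; have sKG : K \subset G by apply: subsetIl.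
have sMG : H :&: K \subset G by rewrite subIset ?sHG.
exists (H :&: K)%G; split=> //.
- rewrite /abelian; apply: subset_trans (subsetIr _ _) _.
  by apply: subset_trans (subsetIr _ _) _; rewrite centS ?subsetIl.
apply/eqP; rewrite eqn_leq cd_measure_le_max //=.
have maxK : (cd_max G <= cd_measure G K)%N.
  rewrite -maxH /cd_measure mulnC leq_mul2l subset_leq_card ?orbT //.
  by rewrite subsetI sHG centsC subsetIr.
have leJ : (cd_measure G (H <*> K) <= cd_max G)%N.
  by rewrite cd_measure_le_max // join_subG sHG.
have max_gt0 : (0 < cd_max G)%N by rewrite -maxH muln_gt0 !cardG_gt0.
rewrite -(leq_pmul2r max_gt0).
apply: (@leq_trans (cd_measure G H * cd_measure G K)).
  by rewrite leq_mul ?maxH.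
apply: leq_trans (leq_mul (leqnn _) leJ).
(* Both products of orders become the order of a product set times that of an intersection. The
   product sets lie in [H <*> K] and in the centralizer of [H :&: K]. *)
rewrite /cd_measure mulnACA (mul_cardG H K) (mul_cardG 'C_G(H) 'C_G(K)).
have -> : 'C_G(H) :&: 'C_G(K) = 'C_G(H <*> K) by rewrite centY setIACA setIid.
rewrite [(#|(H * K)%g| * _)%N]mulnC mulnACA.
apply: leq_mul; apply: leq_mul => //; apply: subset_leq_card.
  by rewrite mul_subG // setIS // centS ?subsetIl ?subsetIr.
by rewrite mul_subG ?joing_subl ?joing_subr.
Qed.

End Measure.

(** * Groups of squarefree order and the exclusion of squarefree [d > 1] *)

Section SquareFree.

Local Open Scope group_scope.

(** The residue 0 is not coprime to [n], so at most [n - 1] residues are counted. *)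
Lemma totient_lt n : (1 < n)%N -> (totient n < n)%N.
Proof.
case: n => [|[|n]] // _; rewrite totient_count_coprime big_ltn //.
rewrite /coprime gcdn0 add0n ltnS.
apply: (@leq_trans (\sum_(1 <= d < n.+2) 1)); last first.
  by rewrite sum_nat_const_nat muln1.
by apply: leq_sum => d _; case: eqP.
Qed.

(** The conjugation action of [N] on [H] has kernel ['C_N(H)] and image in [Aut H]. *)
Lemma index_cent_dvd_Aut (gT : finGroupType) (H N : {group gT}) :
  N \subset 'N(H) -> #|N : 'C(H)| %| #|Aut H|.
Proof.
move=> nHN; rewrite -ker_conj_aut -{1}(setIidPr nHN) -card_morphim.
exact: cardSg (Aut_conj_aut _ _).
Qed.

Lemma logn_cardS (gT : finGroupType) (G H : {group gT}) p :
  H \subset G -> (logn p #|H| <= logn p #|G|)%N.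
Proof. by move=> sHG; rewrite dvdn_leq_log ?cardG_gt0 ?cardSg. Qed.

(** Each Sylow subgroup is trivial or of prime order, hence cyclic, and a nilpotent group with
    cyclic Sylow subgroups is cyclic. *)
Lemma cyclic_abelian_sqfree (gT : finGroupType) (G : {group gT}) :
  (forall p, logn p #|G| <= 1)%N -> abelian G -> cyclic G.
Proof.
move=> sqG abG; apply: nil_Zgroup_cyclic (abelian_nil abG).
apply/forall_inP => P /SylowP[p pr_p sylP].
have := card_Hall sylP; rewrite p_part.
case: logn (sqG p) => [|[|//]] _ oP; last by rewrite prime_cyclic ?oP.
by rewrite (card1_trivg oP) cyclic1.
Qed.

(* Let [S] be a Sylow subgroup for the smallest prime divisor [p]. Then [S] has
   order [p] and is central in its normalizer, so the transfer [G -> S] maps a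
   generator [g] of [S] to [g ^+ #|G : S|], which is nontrivial; its kernel is a
   proper normal subgroup with abelian quotient. *)
Lemma solvable_sqfree (gT : finGroupType) (G : {group gT}) :
  (forall p, logn p #|G| <= 1)%N -> solvable G.
Proof.
have [n] := ubnP #|G|; elim: n => // n IHn in G * => leGn sqG.
have [G1 | ntG] := eqVneq #|G| 1%N.
  by rewrite (card1_trivg G1) solvable1.
have G_gt1 : (1 < #|G|)%N by rewrite ltn_neqAle eq_sym ntG cardG_gt0.
set p := pdiv #|G|; have pr_p : prime p by apply: pdiv_prime.
have [S sylS] := Sylow_exists p G; have sSG := pHall_sub sylS.
have oS : #|S| = p.
  rewrite (card_Hall sylS) p_part; apply/eqP; rewrite -[X in _ == X]expn1.
  by rewrite eqn_exp2l ?prime_gt1 // eqn_leq sqG logn_gt0 pi_pdiv.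
have cycS : cyclic S by rewrite prime_cyclic ?oS.
have /cyclicP[g defS] := cycS; have Sg : g \in S by rewrite defS cycle_id.
(* The index of the centralizer in ['N_G(S)] divides [p - 1], but its prime factors divide [#|G|]
   and so are at least [p]. *)
have sNC : 'N_G(S) \subset 'C(S).
  rewrite -indexg_eq1; apply: contraT => nt_i.
  have i_gt1 : (1 < #|'N_G(S) : 'C(S)|)%N.
    by rewrite ltn_neqAle eq_sym nt_i indexg_gt0.
  have := index_cent_dvd_Aut (subsetIr G 'N(S)).
  rewrite card_Aut_cyclic // oS totient_prime // => dvd_i.
  have oN := cardSg (subsetIl G 'N(S)).
  have := pdiv_min_dvd i_gt1 (dvdn_trans (dvdn_indexg _ _) oN).
  have p1_gt0 : (0 < p.-1)%N by rewrite -ltnS prednK ?prime_gt0 ?prime_gt1.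
  move/leq_trans/(_ (dvdn_leq p1_gt0 dvd_i)).
  by rewrite -ltnS prednK ?prime_gt0 ?ltnn.
have abS : abelian (idm S @* S) by rewrite morphim_idm ?cyclic_abelian.
pose tau := transfer_morphism G abS; have Gg := subsetP sSG g Sg.
have nt_tau : g \notin 'ker tau.
  apply/negP => /mker tau_g.
  have Sg' : g \in idm S @* S by rewrite morphim_idm.
  suff gX : g ^+ #|G : S| = 1.
    have /and3P[_ _] := sylS; rewrite p'natE // => /negP[].
    by have <- : #[g] = p; rewrite ?order_dvdn ?gX // -oS defS.
  have trX := transversalP (rcosets_cycle_partition sSG Gg).
  have := transfer_cycle_expansion sSG abS Gg trX.
  rewrite -[transfer _ _ _]/(tau g) tau_g.
  pose gS := FiniteModule.fmod abS g.
  (* The transfer of [g] is a sum over the cycles of [g] on the cosets of [S], each term a conjugate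
     of a power of [g]. Once the conjugations are removed, the cycle lengths add up to
     [#|G : S|]. *)
  rewrite (eq_bigr (fun x => gS *+ #|<[g]> : S :* x|)%R) => [|x Xx].
    rewrite GRing.sumrMnr (sum_index_rcosets_cycle sSG Gg trX).
    rewrite -FiniteModule.fmodX // => /(congr1 val).
    by rewrite FiniteModule.fmodK ?groupX // => <-.
  have Syx : x * g ^+ #|<[g]> : S :* x| * x^-1 \in S.
    by rewrite -mem_rcoset mulg_exp_card_rcosets.
  rewrite -FiniteModule.fmodX //=; congr (FiniteModule.fmod _ _).
  set y := g ^+ _ in Syx *.
  (* A nontrivial [y] generates [S]. Since its conjugate by [x^-1] is again in [S], the element
     [x^-1] normalizes [S] and therefore centralizes [y]. *)
  have [-> | nt_y] := eqVneq y 1; first by rewrite conj1g.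
  have def_y : <[y]> = S.
    apply/eqP; rewrite eqEcard cycle_subG groupX //= oS.
    have := order_dvdG (groupX #|<[g]> : S :* x| Sg); rewrite oS.
    by move/(prime_nt_dvdP pr_p) => /= <- //; rewrite order_eq1.
  have Gx : x \in G by apply: subsetP Xx; apply: transversal_sub trX.
  have nSx : x^-1 \in 'N_G(S).
    rewrite !inE groupV Gx -{1}def_y -cycleJ cycle_subG conjgE invgK mulgA.
    exact: Syx.
  by rewrite conjgE -(centP (subsetP sNC _ nSx)) ?mulKg ?groupX.
have nKG : 'ker tau <| G := ker_normal tau.
have sKG := normal_sub nKG.
have ltKG : (#|'ker tau| < #|G|)%N.
  rewrite proper_card // properE sKG; apply: contra nt_tau => sGK.
  exact: (subsetP sGK).
rewrite (series_sol nKG) IHn ?(leq_trans ltKG) //=.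
  apply: abelian_sol; rewrite (isog_abelian (first_isog tau)).
  exact: FinRing.zmod_abelian.
by move=> q; apply: leq_trans (logn_cardS q sKG) (sqG q).
Qed.

(* [F] is a maximal normal abelian subgroup: otherwise ['C_G(F) / F] contains a
   nontrivial cyclic [E / F] normal in [G / F], and [E] is abelian as [F] is
   central in [E]. *)
Lemma sqfree_self_centralizing (gT : finGroupType) (G : {group gT}) :
  (forall p, logn p #|G| <= 1)%N ->
  exists F : {group gT}, [/\ F <| G, cyclic F & 'C_G(F) \subset F].
Proof.
move=> sqG; have solG := solvable_sqfree sqG.
have [|/= F /maxgroupP[/andP[nFG abF] maxF] _] :=
    @maxgroup_exists _ (fun H : {group gT} => (H <| G) && abelian H) 1%G.
  by rewrite normal1 abelian1.
have sFG := normal_sub nFG; exists F; split=> //.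
  apply: cyclic_abelian_sqfree abF => p.
  exact: leq_trans (logn_cardS p sFG) (sqG p).
have sCG := subsetIl G 'C(F); have nF := normal_norm nFG.
have nCG : 'C_G(F) <| G by rewrite /normal sCG normsI ?normG ?norms_cent.
have sFC : F \subset 'C_G(F) by rewrite subsetI sFG.
apply: contraT => nsCF.
have ntCF : 'C_G(F)%G / F != 1.
  by rewrite -subG1 quotient_sub1 // (subset_trans sCG).
have solC : solvable ('C_G(F)%G / F) by rewrite quotient_sol ?(solvableS sCG).
have [H [sHC nHG ntH /is_abelemP[q _ /abelem_abelian abH]]] :=
  solvable_norm_abelem solC (quotient_normal F nCG) ntCF.
have [E defH sFE nEG] := inv_quotientN nFG nHG.
have sEC : E \subset 'C(F).
  have: E \subset 'C_G(F).
    by rewrite -(quotientSGK _ sFC) -?defH // (subset_trans (normal_sub nEG)).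
  by rewrite subsetI => /andP[].
have cycH : cyclic (E / F).
  rewrite -defH; apply: cyclic_abelian_sqfree abH => p.
  rewrite defH /= (leq_trans _ (sqG p)) // dvdn_leq_log ?cardG_gt0 //.
  exact: dvdn_trans (dvdn_quotient _ _) (cardSg (normal_sub nEG)).
have abE : abelian E.
  by apply: cyclic_factor_abelian cycH; rewrite subsetI sFE centsC.
by case/eqP: ntH; rewrite defH -(maxF E) ?nEG ?trivg_quotient.
Qed.

Lemma cd_sqfree_eq1 (gT : finGroupType) (G : {group gT}) d :
  (forall p, logn p d <= 1)%N -> (cd_max G * d = #|G| ^ 2)%N -> d = 1%N.
Proof.
move=> sqd defd; have [M [sMG abM maxM]] := cd_max_attained_abelian G.
have sMK : M \subset 'C_G(M) by rewrite subsetI sMG.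
have {}defd : d = (#|'C_G(M) : M| * #|G : 'C_G(M)| ^ 2)%N.
  move: defd; rewrite -maxM /cd_measure -(Lagrange (subsetIl G 'C(M))).
  rewrite -(Lagrange sMK); have := indexg_gt0 'C_G(M) M.
  move: #|'C_G(M) : M| #|G : 'C_G(M)| => k i k_gt0 eq_d.
  apply/eqP; rewrite -(@eqn_pmul2l (#|M| * (#|M| * k))).
    by rewrite eq_d !expnMn; apply/eqP; lia.
  by rewrite !muln_gt0 !cardG_gt0 k_gt0.
(* This index enters [d] squared, so any prime factor of it would divide [d] twice. *)
have iG1 : #|G : 'C_G(M)| = 1%N.
  apply/eqP; rewrite -[_ == _]negbK; apply/negP => nt_i.
  have := sqd (pdiv #|G : 'C_G(M)|).
  rewrite defd lognM ?expn_gt0 ?indexg_gt0 // lognX.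
  suff: (0 < logn (pdiv #|G : 'C_G(M)|) #|G : 'C_G(M)|)%N by lia.
  by rewrite logn_gt0 pi_pdiv ltn_neqAle eq_sym nt_i indexg_gt0.
have cMG : G \subset 'C(M).
  by apply/setIidPl/eqP; rewrite eqEsubset subsetIl -indexg_eq1 iG1.
have nMG : M <| G by rewrite /normal sMG cents_norm.
have oQ : #|G / M| = d.
  by rewrite card_quotient ?normal_norm // defd iG1 (setIidPl cMG) muln1.
have sqQ p : (logn p #|G / M| <= 1)%N by rewrite oQ.
have [F [nFQ cycF sCF]] := sqfree_self_centralizing sqQ.
have [A defF sMA nAG] := inv_quotientN nMG nFQ.
have sAG := normal_sub nAG.
have abA : abelian A.
  apply: (@cyclic_factor_abelian _ M); last by rewrite -defF.
  by rewrite subsetI sMA (centsS sAG) // centsC.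
have [F1 | ntF] := eqVneq #|F| 1%N.
  move: sCF; rewrite (card1_trivg F1) -oQ => sQ1; apply/eqP.
  rewrite -trivg_card1 -subG1; apply: subset_trans sQ1.
  by rewrite subsetI subxx centsC sub1G.
have F_gt1 : (1 < #|F|)%N by rewrite ltn_neqAle eq_sym ntF cardG_gt0.
(* As [F] contains its centralizer, its index is at most that of the centralizer, which is bounded
   by [#|Aut F|], the totient of [#|F|]. *)
have ltQ : (#|G / M| < #|F| ^ 2)%N.
  rewrite -(Lagrange (normal_sub nFQ)) expnS expn1 ltn_pmul2l ?cardG_gt0 //.
  apply: leq_ltn_trans (totient_lt F_gt1); rewrite -card_Aut_cyclic //.
  have := index_cent_dvd_Aut (normal_norm nFQ).
  move/(dvdn_leq (cardG_gt0 _)); apply: leq_trans.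
  by rewrite -[leqRHS]indexgI dvdn_leq ?indexg_gt0 // indexgS.
have := cd_measure_le_max sAG; rewrite -maxM /cd_measure leqNgt.
case/negP; apply: (@leq_trans (#|A| * #|A|)); last first.
  by rewrite leq_mul // subset_leq_card // subsetI sAG.
rewrite (setIidPl cMG) -(Lagrange sMG) -(Lagrange sMA).
move: ltQ; rewrite /= defF !card_quotient ?normal_norm //; last first.
  exact: normalS nMG.
have := cardG_gt0 M; move: #|M| #|A : M| #|G : M| => m a g m_gt0 ltQ.
by rewrite mulnACA mulnA ltn_pmul2l // muln_gt0 m_gt0.
Qed.

End SquareFree.

(** * Multiplicativity on direct products *)

Section Product.

Local Open Scope group_scope.

(** [H] lies in the product of its projections, and its centralizer in the product of theirs.
    Conversely, the product of two optimal subgroups is centralized by the product of their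
    centralizers. *)
Lemma cd_max_setX (gT1 gT2 : finGroupType)
    (G1 : {group gT1}) (G2 : {group gT2}) :
  cd_max (setX_group G1 G2) = (cd_max G1 * cd_max G2)%N.
Proof.
apply/eqP; rewrite eqn_leq; apply/andP; split.
  apply/bigmax_leqP => H sHG.
  pose H1 := (@fst _ _ @* H)%G; pose H2 := (@snd gT1 gT2 @* H)%G.
  have H1P u : u \in H -> u.1 \in H1.
    by move=> Hu; apply: mem_morphim; rewrite ?inE.
  have H2P u : u \in H -> u.2 \in H2.
    by move=> Hu; apply: mem_morphim; rewrite ?inE.
  have sH1 : H1 \subset G1.
    apply/subsetP => _ /morphimP[u _ /(subsetP sHG) + ->].
    by rewrite inE => /andP[].
  have sH2 : H2 \subset G2.
    apply/subsetP => _ /morphimP[u _ /(subsetP sHG) + ->].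
    by rewrite inE => /andP[].
  apply: leq_trans (leq_mul (cd_measure_le_max sH1) (cd_measure_le_max sH2)).
  rewrite /cd_measure mulnACA -(cardsX H1 H2) -(cardsX 'C_G1(H1) 'C_G2(H2)).
  apply: leq_mul; apply: subset_leq_card.
    by apply/subsetP => u Hu; rewrite inE H1P ?H2P.
  apply/subsetP => u; rewrite !inE -andbA => /and3P[-> -> /centP cu] /=.
  by apply/andP; split; apply/centP => _ /morphimP[v _ Hv ->];
    have [] := cu v Hv.
have [H1 sH1 <-] := cd_max_attained G1; have [H2 sH2 <-] := cd_max_attained G2.
apply: leq_trans (cd_measure_le_max (_ : setX_group H1 H2 \subset _)); last first.
  apply/subsetP => u; rewrite !inE.
  by move=> /andP[/(subsetP sH1)-> /(subsetP sH2)->].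
rewrite /cd_measure mulnACA -(cardsX H1 H2) -(cardsX 'C_G1(H1) 'C_G2(H2)).
rewrite leq_mul // subset_leq_card //.
apply/subsetP => u; rewrite !inE.
move=> /andP[/andP[-> /centP c1] /andP[-> /centP c2]] /=.
apply/centP => v; rewrite inE => /andP[/c1 e1 /c2 e2].
by congr (_, _).
Qed.

End Product.

(** * The group on V x (V (x) V) and its maximal measure *)

Section TensorGroup.

Import GRing.Theory.
Local Open Scope ring_scope.

Variables (F : finFieldType) (n : nat).

(* A record rather than the bare pair type, which already carries the direct
   product group structure. *)
Record tensor_group := TensorGroup { tg_pair : 'rV[F]_n * 'M[F]_n }.

HB.instance Definition _ := [isNew for tg_pair].
HB.instance Definition _ := [Finite of tensor_group by <:].

Implicit Types x y : tensor_group.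

Definition tg_vec x := (tg_pair x).1.
(** Square matrices model V (x) V: the tensor of row vectors [u] and [v] is the matrix
    [u^T *m v]. *)
Definition tg_mul x y := TensorGroup
  (tg_vec x + tg_vec y,
   (tg_pair x).2 + (tg_pair y).2 + (tg_vec x)^T *m tg_vec y).
Definition tg_one := TensorGroup (0, 0).
Definition tg_inv x := TensorGroup
  (- tg_vec x, - (tg_pair x).2 + (tg_vec x)^T *m tg_vec x).

Fact tg_mulA : associative tg_mul.
Proof.
move=> [[u A]] [[v B]] [[w C]]; congr (TensorGroup (_, _)); rewrite /tg_vec /=.
  exact: addrA.
rewrite mulmxDr [(u + v)^T]linearD mulmxDl !addrA.
by rewrite [LHS](ACl (1*2*5*3*6*4))%AC.
Qed.

Fact tg_mul1 : left_id tg_one tg_mul.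
Proof.
move=> [[u A]]; congr (TensorGroup (_, _)); rewrite /tg_vec /= ?add0r //.
by rewrite trmx0 mul0mx addr0.
Qed.

Fact tg_mulV : left_inverse tg_one tg_inv tg_mul.
Proof.
move=> [[u A]]; congr (TensorGroup (_, _)); rewrite /tg_vec /=.
  exact: addNr.
by rewrite linearN mulNmx [X in X - _]addrAC addNr add0r subrr.
Qed.

HB.instance Definition _ :=
  Finite_isGroup.Build tensor_group tg_mulA tg_mul1 tg_mulV.

Lemma commute_tgP x y :
  commute x y <-> (tg_vec x)^T *m tg_vec y = (tg_vec y)^T *m tg_vec x.
Proof.
case: x y => [[u A]] [[v B]]; split=> [eq_xy | eq_uv].
  move: (congr1 (fun x => (tg_pair x).2) eq_xy).
  by rewrite /= [B + A]addrC => /addrI.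
congr (TensorGroup (_, _)); first exact: addrC.
by rewrite /= eq_uv [B + A]addrC.
Qed.

Let q := #|F|.
Let z := #|{: 'M[F]_n}|.

Lemma card_tensor_group : #|[set: tensor_group]| = (q ^ n * z)%N.
Proof.
rewrite cardsT; have tg_bij : bijective tg_pair by exists TensorGroup => [[]|].
by rewrite (bij_eq_card tg_bij) card_prod card_mx mul1n.
Qed.

(** Comparing row [i] of the two outer products, where [x] has a nonzero entry, shows that a
    commuting vector is one of the [q] multiples of that of [x]; the matrix part is free. *)
Lemma card_cent1_tensor x : tg_vec x != 0 -> (#|'C[x]%g| <= q * z)%N.
Proof.
move=> /rV0Pn[i xi_neq0]; rewrite -card_prod.
apply: leq_trans (leq_imset_card
  (fun aB : F * 'M_n => TensorGroup (aB.1 *: tg_vec x, aB.2)) _).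
apply/subset_leq_card/subsetP => y /cent1P/commute_tgP eq_xy.
apply/imsetP; exists (tg_vec y 0 i / tg_vec x 0 i, (tg_pair y).2) => //.
case: y eq_xy => [[v B]]; rewrite /tg_vec /= => eq_xy.
congr (TensorGroup (_, _)); apply/rowP => j; rewrite mxE.
have /matrixP/(_ i j) := eq_xy; rewrite !mxE !big_ord1 !mxE => eq_ij.
by apply: (mulfI xi_neq0); rewrite mulrA mulrCA divff // mulr1.
Qed.

Lemma card_vec0_tensor (A : {set tensor_group}) :
  {in A, forall x, tg_vec x = 0} -> (#|A| <= z)%N.
Proof.
move=> A0; apply: leq_trans (leq_imset_card (fun B => TensorGroup (0, B)) _).
apply/subset_leq_card/subsetP => [[[v B]]] /A0 /=; rewrite /tg_vec /= => ->.
exact: imset_f.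
Qed.

Lemma center_tensor_geq :
  (z <= #|'C_[set: tensor_group]([set: tensor_group])%g|)%N.
Proof.
have inj0 : injective (fun B : 'M[F]_n => TensorGroup (0, B)) by move=> B C [].
rewrite /z -(card_imset _ inj0).
apply/subset_leq_card/subsetP => _ /imsetP[B _ ->].
rewrite inE in_setT; apply/centP => y _; apply/commute_tgP.
by rewrite /tg_vec /= trmx0 mul0mx mulmx0.
Qed.

(** If [H] or its centralizer has only zero vectors, it has at most [z] elements. Otherwise each
    centralizes an element with nonzero vector, so the measure is at most [q ^ 2 * z ^ 2], and
    [n > 1] gives [q ^ 2 <= q ^ n]. *)
Lemma cd_max_tensor : (1 < n)%N ->
  cd_max [set: tensor_group]%G = (#|[set: tensor_group]| * z)%N.
Proof.
move=> n_gt1; apply/eqP; rewrite eqn_leq; apply/andP; split; last first.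
  apply: leq_trans (cd_measure_le_max (subxx [set: tensor_group]%G)).
  by rewrite leq_mul2l center_tensor_geq orbT.
apply/bigmax_leqP => H _; rewrite /cd_measure setTI.
have [/existsP[h /andP[Hh vh]] | /existsPn H0] :=
    boolP [exists h, (h \in H) && (tg_vec h != 0)]; last first.
  rewrite mulnC leq_mul ?subset_leq_card ?subsetT //.
  apply: card_vec0_tensor => x Hx; apply/eqP.
  by have := H0 x; rewrite Hx negbK.
have [/existsP[c /andP[Cc vc]] | /existsPn C0] :=
    boolP [exists c, (c \in 'C(H)%g) && (tg_vec c != 0)]; last first.
  rewrite leq_mul ?subset_leq_card ?subsetT //.
  apply: card_vec0_tensor => x Cx; apply/eqP.
  by have := C0 x; rewrite Cx negbK.
apply: (@leq_trans ((q * z) * (q * z))).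
  apply: leq_mul; [apply: leq_trans (card_cent1_tensor vc) |
                   apply: leq_trans (card_cent1_tensor vh)].
    by rewrite subset_leq_card // sub_cent1.
  by rewrite subset_leq_card // -cent_set1 centS ?sub1set.
rewrite card_tensor_group mulnACA -[leqRHS]mulnA leq_mul2r [(q * q)%N]mulnn.
rewrite leq_pexp2l ?orbT //.
by apply/card_gt0P; exists 0.
Qed.

End TensorGroup.

(** * Realizable values of [d], and the prime factorization *)

Definition realizable d :=
  exists (gT : finGroupType) (G : {group gT}), cd_max G * d = #|G| ^ 2.

Lemma realizable1 : realizable 1.
Proof.
exists {perm void}, 1%G; rewrite cards1 muln1 /cd_max.
apply/eqP; rewrite eqn_leq.
apply/andP; split.
  apply/bigmax_leqP => H /subset_leq_card; rewrite cards1 => leH.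
  rewrite /cd_measure -[1 ^ 2]/(1 * 1) leq_mul //.
  by apply: leq_trans (subset_leq_card (subsetIl _ _)) _; rewrite cards1.
apply: leq_trans (cd_measure_le_max (subxx _)).
by rewrite muln_gt0 !cardG_gt0.
Qed.

Lemma realizableM d e : realizable d -> realizable e -> realizable (d * e).
Proof.
move=> [gT1 [G1 defd]] [gT2 [G2 defe]].
exists (gT1 * gT2)%type, (setX_group G1 G2).
by rewrite cd_max_setX mulnACA defd defe cardsX expnMn.
Qed.

Lemma realizable_prime_power p n : prime p -> 1 < n -> realizable (p ^ n).
Proof.
move=> pr_p n_gt1; exists (tensor_group 'F_p n), [set: tensor_group 'F_p n]%G.
have := card_tensor_group 'F_p n; rewrite card_Fp // => oG.
by rewrite cd_max_tensor // -mulnA [_ * p ^ n]mulnC -oG mulnn.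
Qed.

Lemma logn_prod (I : finType) (F : I -> nat) q :
  (forall i, 0 < F i) -> logn q (\prod_i F i) = \sum_i logn q (F i).
Proof.
(* Positivity is carried through the induction because [lognM] requires it of both factors. *)
move=> F_gt0; pose K m s := 0 < m /\ logn q m = s.
suff [] : K (\prod_i F i) (\sum_i logn q (F i)) by [].
apply: big_rec2 => [|i m s _ [s_gt0 <-]]; first by split; rewrite ?logn1.
by split; rewrite ?lognM // muln_gt0 F_gt0.
Qed.

Lemma logn_prod_primes (I : finType) (p : I -> nat) q :
  (forall i, prime (p i)) -> injective p -> logn q (\prod_i p i) <= 1.
Proof.
move=> p_prime p_inj; rewrite logn_prod => [|i]; last exact: prime_gt0.
rewrite (eq_bigr (fun i => if q == p i then 1 else 0)) => [|i _]; last first.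
  by rewrite logn_prime.
rewrite -big_mkcond sum1_card; apply/card_le1_eqP => i j /eqP qi /eqP qj.
by apply: p_inj; rewrite -qi.
Qed.

Theorem theorem1p2 (d k : nat) (p n : 'I_k -> nat)
    (d_gt0 : 0 < d) (k_gt0 : 0 < k)
    (p_prime : forall i, prime (p i)) (p_inj : injective p)
    (dE : d = \prod_(i < k) p i ^ n i) :
  ((forall i, n i = 0) \/ (forall i, 2 <= n i) ->
     exists (gT : finGroupType) (G : {group gT}),
       cd_ratio G = (1 / d%:R)%R)
  /\
  ((forall i, n i = 1) ->
     ~ exists (gT : finGroupType) (G : {group gT}),
         cd_ratio G = (1 / d%:R)%R).
Proof.
split=> [n_cases | n1 [gT [G]]].
  suff [gT [G defd]] : realizable d by exists gT, G; apply/cd_ratioP.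
  rewrite dE; apply: big_ind => [||i _].
  - exact: realizable1.
  - exact: realizableM.
  case: n_cases => n_i; first by rewrite n_i; apply: realizable1.
  exact: realizable_prime_power.
have {}dE : d = \prod_(i < k) p i.
  by rewrite dE; apply: eq_bigr => i _; rewrite n1.
move/(cd_ratioP _ d_gt0)/cd_sqfree_eq1 => d1.
have {}d1 : d = 1 by apply: d1 => q; rewrite dE logn_prod_primes.
(* Since [k] is positive, some prime divides [d], which contradicts [d = 1]. *)
have : p (Ordinal k_gt0) %| d.
  by rewrite dE (bigD1 (Ordinal k_gt0)) //= dvdn_mulr.
by rewrite d1 dvdn1 => /eqP p1; have := p_prime (Ordinal k_gt0); rewrite p1.
Qed.
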